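(* The solution space of the linear recursion equations $$\eta(2m_1+r_1,\ldots,2m_{n-1}+r_{n-1})=\frac{(-1)^r}{2}\Bigl(\eta(m_1,\ldots,m_{n-1})+(-1)^n\,\eta(m_1+r_1,\ldots,m_{n-1}+r_{n-1})\Bigr),$$ for all integers $m_1,\ldots,m_{n-1}\geqslant 0$ and all $r_1,\ldots,r_{n-1}\in\{0,1\}$, where $r=r_1+\cdots+r_{n-1}$, regarded as an infinite set of linear equations for the coefficients $\eta(m_1,\ldots,m_{n-1})$, is one-dimensional. Consequently, for any $n\in\mathbb{N}$, the $n$-point correlations of the balanced Thue--Morse system are uniquely specified by a single number, namely by $\eta(0,\ldots,0)$.
   Context: The Thue--Morse sequence $(t_k)_{k\geqslant 0}$ with values $\pm1$ is defined by $t_0=1$, $t_{2k}=t_k$, $t_{2k+1}=-t_k$ for $k\geqslant 0$. Its bi-infinite extension is $w=(w_n)_{n\in\mathbb{Z}}$ with $w_n=t_n$ for $n\geqslant 0$ and $w_n=t_{-n-1}$ for $n<0$. Let $(Sx)_i=x_{i+1}$ be the shift on $\{\pm1\}^{\mathbb{Z}}$ and let $\mathbb{X}=\overline{\{S^iw:i\in\mathbb{Z}\}}\subset\{\pm1\}^{\mathbb{Z}}$ (closure in the product topology). The system $(\mathbb{X},\mathbb{Z})$ is strictly ergodic (minimal and uniquely ergodic), and $\mu$ denotes its unique shift-invariant probability measure. The $n$-point correlations of the balanced Thue--Morse system are $$\eta(m_1,\ldots,m_{n-1})=\int_{\mathbb{X}}x_0\,x_{m_1}\cdots x_{m_{n-1}}\,\mathrm{d}\mu(x).$$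 These correlations satisfy the recursion equations displayed in the claim.
   Formalization: The solution space is shown to be one-dimensional only for even n; for odd n the equation with all m_i=r_i=0 forces η(0,…,0)=0, so the space is {0}, and dimension 0 is proved instead; the second sentence is kept for all n≥1. *)

(* Defs.v *)
From HB Require Import structures.
From mathcomp Require Export all_boot all_order all_algebra.
From mathcomp Require Export all_classical all_reals all_analysis.

Set Implicit Arguments.
Unset Strict Implicit.
Unset Printing Implicit Defensive.
Import Order.TTheory GRing.Theory Num.Theory.
Import numFieldNormedType.Exports.
Local Open Scope classical_set_scope.
Local Open Scope ring_scope.

(* The alphabet {+1, -1} is encoded by [bool], the letter [b] standing for the
   number (-1) ^+ b; negation of a letter is thus [~~]. *)
Definition sign (R : realType) (b : bool) : R := (-1) ^+ b.

(* [thue_morse_rec d k] is correct as soon as [k <= d]. *)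
Fixpoint thue_morse_rec (d k : nat) : bool :=
  if d is d'.+1 then
    if k == 0%N then false else odd k (+) thue_morse_rec d' k./2
  else false.

Definition thue_morse (k : nat) : bool := thue_morse_rec k k.

Lemma thue_morse_recE (d k : nat) :
  (k <= d)%N -> thue_morse_rec d k = thue_morse k.
Proof.
suff H e d1 d2 j : (j <= e)%N -> (j <= d1)%N -> (j <= d2)%N ->
    thue_morse_rec d1 j = thue_morse_rec d2 j by move=> kd; exact: (H k).
elim: e d1 d2 j => [|e IH] [|d1] [|d2] [|j] //= je jd1 jd2.
have h : (uphalf j <= j)%N.
  by rewrite -{2}(odd_double_half j) uphalf_half -addnn leq_add2l leq_addr.
by congr (_ (+) _); apply: IH; apply: (leq_trans h).
Qed.


Lemma thue_morse0 : thue_morse 0 = false.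
Proof. by []. Qed.

Lemma thue_morse_half (k : nat) :
  (0 < k)%N -> thue_morse k = odd k (+) thue_morse k./2.
Proof.
case: k => [//|k] _; rewrite {1}/thue_morse /thue_morse_rec -/thue_morse_rec /=.
by rewrite thue_morse_recE // leq_uphalf_double -addnn leq_addr.
Qed.

Lemma thue_morse_double (k : nat) : thue_morse k.*2 = thue_morse k.
Proof.
by case: k => [//|k]; rewrite thue_morse_half ?double_gt0// odd_double doubleK.
Qed.

Lemma thue_morse_doubleS (k : nat) : thue_morse k.*2.+1 = ~~ thue_morse k.
Proof. by rewrite thue_morse_half //= odd_double uphalf_double addTb. Qed.

Definition bi_seq : Type := prod_topology (fun _ : int => bool).
HB.instance Definition _ := Topological.on bi_seq.
HB.instance Definition _ := Pointed.on bi_seq.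

Notation borel_bi_seq := (g_sigma_algebraType (@open bi_seq)).

Definition shift (i : int) (x : bi_seq) : bi_seq := fun j => x (j + i).

(* [Negz k] is the integer -k-1. *)
Definition w : bi_seq :=
  fun i => match i with Posz k => thue_morse k | Negz k => thue_morse k end.

Definition hull : set bi_seq := closure [set shift i w | i in [set: int]].

(* Measures on the hull are measures on the full space giving it mass 1. *)
Definition invariant_probability (R : realType)
    (mu : probability borel_bi_seq R) : Prop :=
  mu hull = 1%E /\
  forall A : set borel_bi_seq, measurable A -> mu (shift 1 @^-1` A) = mu A.

Definition unique_invariant_probability (R : realType)
    (mu : probability borel_bi_seq R) : Prop :=
  invariant_probability mu /\
  forall nu : probability borel_bi_seq R, invariant_probability nu ->
    forall A : set borel_bi_seq, measurable A -> nu A = mu A.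

Definition correlation (R : realType) (mu : probability borel_bi_seq R)
    (n : nat) (m : 'I_n.-1 -> int) : R :=
  \int[mu]_(x in hull)
    (sign R (x 0) * \prod_(i < n.-1) sign R ((x : bi_seq) (m i))).

(* The index (m_1, ..., m_(n-1)) is a function on 'I_n.-1; only [0 < n] is
   meaningful. *)
Definition recursion_solutions (R : realType) (n : nat) :
    set (('I_n.-1 -> nat) -> R) :=
  [set eta | forall (m : 'I_n.-1 -> nat) (r : 'I_n.-1 -> bool),
    eta (fun i => 2 * m i + r i)%N =
    (-1) ^+ (\sum_(i < n.-1) r i) / 2 *
    (eta m + (-1) ^+ n * eta (fun i => m i + r i)%N)].

Definition has_dimension (K : fieldType) (V : lmodType K) (S : set V)
    (d : nat) : Prop :=
  exists b : 'I_d -> V,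
    S = [set \sum_(i < d) c i *: b i | c in [set: 'I_d -> K]] /\
    forall c : 'I_d -> K, \sum_(i < d) c i *: b i = 0 -> forall i, c i = 0.

(* Main.v *)
(* Writing an index k as 2 m + r with r = k mod 2, the equation for k expresses
   eta(k) through eta at floor(k/2) and ceil(k/2). These have a smaller maximum
   than k as soon as max k >= 2, and for 0-1 indices the equation can be solved
   for eta(k), so a solution is determined by eta(0). At k = 0 the equation is
   void for even n, where the recursion thus defines a solution with eta(0) = 1,
   and forces eta(0) = 0 for odd n.
   For the correlations, let theta be the substitution 1 -> (1, -1),
   -1 -> (-1, 1), acting on bi-infinite sequences. It maps the hull into itself
   and S^2 theta = theta S, so (theta_* mu + (S theta)_* mu) / 2 is again an
   invariant probability on the hull, hence equal to mu; integrating
   x_0 x_(2 m_1 + r_1) ... against it gives the two terms of the recursion. *)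
From HB Require Import structures.
Require Import Defs.
From mathcomp Require Import zify ring lra.
Set Implicit Arguments.
Unset Strict Implicit.
Unset Printing Implicit Defensive.
Import Order.TTheory GRing.Theory Num.Theory.
Local Open Scope classical_set_scope.
Local Open Scope ring_scope.

(** * The solution space of the recursion equations *)

Section RecursionEquations.
Variable R : realType.

Lemma bits_decomposition (I : Type) (k : I -> nat) :
  k = (fun i => 2 * (k i)./2 + odd (k i))%N.
Proof. by apply/funext => i; lia. Qed.

Lemma recursion_half (n : nat) (f : ('I_n.-1 -> nat) -> R)
    (k : 'I_n.-1 -> nat) : recursion_solutions f ->
  f k = (-1) ^+ (\sum_(i < n.-1) odd (k i)) / 2 *
        (f (fun i => (k i)./2) + (-1) ^+ n * f (fun i => uphalf (k i))).
Proof.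
move=> fS; rewrite {1}(bits_decomposition k) (fS _ (fun i => odd (k i))).
by congr (_ * (_ + _ * f _)); apply/funext => i; rewrite uphalf_half addnC.
Qed.

Lemma recursion_solutions_inj (n : nat) (f g : ('I_n.-1 -> nat) -> R) :
  recursion_solutions f -> recursion_solutions g ->
  f (fun=> 0%N) = g (fun=> 0%N) -> f = g.
Proof.
move=> fS gS fg0; apply/funext => k.
have [M] : exists M, forall i, (k i <= M)%N.
  by exists (\max_i k i) => i; exact: leq_bigmax.
elim/ltn_ind: M k => -[|[|M]] IH k kM.
- have -> // : k = fun=> 0%N by apply/funext => i; have := kM i; lia.
(* The halves of a 0-1 index are [0] and [k] itself, so the equation reads [f k = c (f 0 + e f k)]
   with [c] = 1/2 or -1/2 and [e] = 1 or -1. As [c e] is never 1, it determines [f k]. *)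
- have k0 : (fun i => (k i)./2) = fun=> 0%N.
    by apply/funext => i; have := kM i; lia.
  have k1 : (fun i => uphalf (k i)) = k.
    by apply/funext => i; have := kM i; lia.
  have := recursion_half k fS; have := recursion_half k gS.
  rewrite k0 k1 fg0 -[(-1) ^+ n]signr_odd -[(-1) ^+ (\sum_(_ < _) _)]signr_odd.
  by case: (odd _); case: (odd _); rewrite ?expr0 ?expr1; lra.
- rewrite (recursion_half k fS) (recursion_half k gS).
  by congr (_ * (_ + _ * _)); apply: (IH M.+1) => // i; have := kM i; lia.
Qed.

Lemma recursion_solutions_odd_dim (n : nat) :
  odd n -> has_dimension (@recursion_solutions R n) 0.
Proof.
move=> n_odd; have e : (-1) ^+ n = -1 :> R by rewrite -signr_odd n_odd.
have zS : recursion_solutions (fun=> 0 : R) (n := n).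
  by move=> m r; rewrite mulr0 addr0 mulr0.
exists (fun=> 0); split; last by move=> ? _ [].
apply/seteqP; split => f /=.
  move=> fS; exists (fun=> 0) => //; rewrite big_ord0.
  apply: (recursion_solutions_inj zS fS).
  have := recursion_half (fun=> 0%N) fS.
  by rewrite e /= mulN1r subrr mulr0 => ->.
by move=> [c _ <-]; rewrite big_ord0.
Qed.

(* [s / (2 - s)] solves [x = s / 2 * (1 + x)]. *)
Fixpoint even_solution_rec (d fuel : nat) (k : 'I_d -> nat) : R :=
  let s := (-1) ^+ (\sum_(i < d) odd (k i)) in
  if [forall i, k i <= 1]%N then s / (2 - s) else
  if fuel is fuel'.+1 then
    s / 2 * (even_solution_rec fuel' (fun i => (k i)./2) +
             even_solution_rec fuel' (fun i => uphalf (k i)))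
  else 0.

Definition even_solution (d : nat) (k : 'I_d -> nat) : R :=
  even_solution_rec (\max_(i < d) k i) k.

(** Halving lowers any maximum above 1 and the recursion stops at 0-1 indices, so fuel one below the
    maximum suffices and the default value [0] is never reached. *)
Lemma even_solution_recE (d fuel : nat) (k : 'I_d -> nat) :
  (forall i, k i <= fuel.+1)%N -> even_solution_rec fuel k = even_solution k.
Proof.
suff H M e1 e2 (j : 'I_d -> nat) : (forall i, j i <= M.+1)%N ->
    (forall i, j i <= e1.+1)%N -> (forall i, j i <= e2.+1)%N ->
    even_solution_rec e1 j = even_solution_rec e2 j.
  by move=> kf; apply: (H fuel) => // i; apply/leqW/leq_bigmax.
elim: M e1 e2 j => [|M IH] e1 e2 j jM j1 j2.
  have h : [forall i, j i <= 1]%N by apply/forallP.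
  by case: e1 e2 {j1 j2} => [|e1] [|e2] /=; rewrite h.
have [h|/forallPn[i ji]] := boolP [forall i, j i <= 1]%N.
  by case: e1 e2 {j1 j2} => [|e1] [|e2] /=; rewrite h.
case: e1 j1 => [/(_ i)|e1 j1]; first lia.
case: e2 j2 => [/(_ i)|e2 j2]; first lia.
rewrite /=; case: ifP => // _.
by congr (_ * (_ + _)); apply: IH => l;
  have := jM l; have := j1 l; have := j2 l; lia.
Qed.

Lemma even_solution0 (d : nat) : even_solution (fun=> 0%N : nat) (d := d) = 1.
Proof.
rewrite -(@even_solution_recE _ 0) //= ifT; last exact/forallP.
by rewrite big1 // expr0 -addrA addrN addr0 divr1.
Qed.

(** For an entry above 1 this unfolds the recursion. On 0-1 indices the halves are [0], with value
    1, and [k], which leaves the fixed-point equation solved by [s / (2 - s)]. *)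
Lemma even_solution_half (d : nat) (k : 'I_d -> nat) :
  even_solution k = (-1) ^+ (\sum_(i < d) odd (k i)) / 2 *
    (even_solution (fun i => (k i)./2) + even_solution (fun i => uphalf (k i))).
Proof.
set s := _ ^+ _.
have [h|h] := boolP [forall i, k i <= 1]%N.
  have le1 (j : 'I_d -> nat) : (forall i, j i <= 1)%N -> even_solution j =
      (-1) ^+ (\sum_(i < d) odd (j i)) / (2 - (-1) ^+ (\sum_(i < d) odd (j i))).
    move=> j1; rewrite -(@even_solution_recE _ 0) //=.
    by rewrite ifT //; apply/forallP.
  move/forallP: h => h.
  have -> : (fun i => uphalf (k i)) = k.
    by apply/funext => i; have := h i; lia.
  have -> : (fun i => (k i)./2) = fun=> 0%N.
    by apply/funext => i; have := h i; lia.
  rewrite le1 // even_solution0.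
  by rewrite -/s /s -signr_odd; case: (odd _); rewrite ?expr0 ?expr1; field.
have kM i : (k i <= (\max_i k i))%N by exact: leq_bigmax.
rewrite {1}/even_solution; set M := \max_i k i in kM *.
case: M kM => [|M] kM.
  by case/negP: h; apply/forallP => i; rewrite (leq_trans (kM i)).
rewrite /= (negPf h) -/s.
by rewrite !even_solution_recE // => i; have := kM i; lia.
Qed.

Lemma even_solutionP (n : nat) : ~~ odd n ->
  recursion_solutions (@even_solution n.-1).
Proof.
move=> n_even m r.
have e : (-1) ^+ n = 1 :> R by rewrite -signr_odd (negPf n_even).
rewrite even_solution_half e mul1r.
have -> : (\sum_(i < n.-1) odd (2 * m i + r i) = \sum_(i < n.-1) r i)%N.
  by apply: eq_bigr => i _; lia.
have -> : (fun i => (2 * m i + r i)./2) = m by apply/funext => i; lia.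
by have -> : (fun i => uphalf (2 * m i + r i)) = (fun i => m i + r i)%N
  by apply/funext => i; lia.
Qed.

Lemma recursion_solutions_even_dim (n : nat) :
  ~~ odd n -> has_dimension (@recursion_solutions R n) 1.
Proof.
move=> n_even; pose b := @even_solution n.-1.
have bS : recursion_solutions b by exact: even_solutionP.
have scaleS c : recursion_solutions (c *: b : (_ -> _) -> _) (n := n).
  have scaleE k : (c *: b) k = c * b k by [].
  by move=> m r; rewrite !scaleE bS; ring.
exists (fun=> b); split => [|c].
  apply/seteqP; split => f /=; last by move=> [c _ <-]; rewrite big_ord1.
  (* Since [b] has value 1 at 0, the coefficient must be the value of [f] there. *)
  move=> fS; exists (fun=> f (fun=> 0%N)) => //; rewrite big_ord1.
  apply: (recursion_solutions_inj _ fS) => //.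
  by rewrite fctE /b even_solution0 -[_ *: _]/(_ * _) mulr1.
rewrite big_ord1 => /(congr1 (fun f => f (fun=> 0%N))).
by rewrite fctE /b even_solution0 -[_ *: _]/(_ * _) mulr1 => c0 i; rewrite ord1.
Qed.

End RecursionEquations.

(** * Binary self-similarity of the Thue--Morse word *)

(** [thue_morse] is the parity of the binary digit sum, and the digits of [a] are followed by the
    [k] digits of [j]. *)
Lemma thue_morse_block (k a j : nat) : (j < 2 ^ k)%N ->
  thue_morse (a * 2 ^ k + j) = thue_morse a (+) thue_morse j.
Proof.
elim: k j => [|k IH] j jk.
  have -> : j = 0%N by move: jk; lia.
  by rewrite addn0 muln1 thue_morse0 addbF.
rewrite expnS in jk *.
have -> : (a * (2 * 2 ^ k) + j = odd j + (a * 2 ^ k + j./2).*2)%N by nia.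
have jE : (j = odd j + (j./2).*2)%N by rewrite odd_double_half.
rewrite [in RHS]jE; case: (odd j) in jE *;
  rewrite ?add1n ?add0n ?thue_morse_doubleS ?thue_morse_double IH ?addbN //;
  lia.
Qed.

(** Subtracting from [2 ^ k - 1] complements all [k] binary digits of [j]. *)
Lemma thue_morse_mirror (k j : nat) : (j < 2 ^ k)%N ->
  thue_morse ((2 ^ k).-1 - j) = odd k (+) thue_morse j.
Proof.
elim: k j => [|k IH] j jk.
  by have -> : j = 0%N by move: jk; lia.
rewrite expnS in jk *.
have jE : (j = odd j + (j./2).*2)%N by rewrite odd_double_half.
have -> : ((2 * 2 ^ k).-1 - j = ~~ odd j + ((2 ^ k).-1 - j./2).*2)%N by lia.
have jk2 : (j./2 < 2 ^ k)%N by lia.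
rewrite [in RHS]jE; case: (odd j) in jE *;
  rewrite /= ?add1n ?add0n ?thue_morse_doubleS ?thue_morse_double IH //;
  by case: (odd k); case: (thue_morse _).
Qed.

(** * Topology of the space of bi-infinite sequences *)

Lemma near_proj (x : bi_seq) (j : int) : 
  \forall y \near x, (y : bi_seq) j = x j.
Proof.
apply: (@proj_continuous int (fun=> bool) j x [set x j]); exact: discrete_set1.
Qed.

Lemma cvg_bi_seq (F : set_system bi_seq) (x : bi_seq) : Filter F ->
  (forall j, \forall y \near F, (y : bi_seq) j = x j) -> F --> x.
Proof.
move=> FF Fx; apply/cvg_sup => j A /=.
rewrite (@nbhsE (initial_topology (fun f : int -> bool => f j))).
move=> -[B [[C _ <-] Cx] BA].
by apply: filterS (Fx j) => y /= yx; apply: BA; rewrite /= yx.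
Qed.

Lemma local_continuous (f : bi_seq -> bi_seq) :
  (forall j, exists l, forall x y : bi_seq, x l = y l -> f x j = f y j) ->
  continuous f.
Proof.
move=> floc x; apply: cvg_bi_seq => j.
have [l fl] := floc j.
by apply: filterS (near_proj x l) => y /fl.
Qed.

Lemma continuous_borel (f : borel_bi_seq -> borel_bi_seq) :
  continuous (f : bi_seq -> bi_seq) -> measurable_fun [set: borel_bi_seq] f.
Proof.
move=> /continuousP fc; apply: measurability => //.
by move=> _ [A oA <-]; rewrite setTI; apply: sub_sigma_algebra; exact: fc.
Qed.

Lemma shift_continuous (i : int) : continuous (shift i).
Proof. by apply: local_continuous => j; exists (j + i). Qed.

(** * The substitution and its action on the hull *)

(** The map theta: the letter [x i] becomes the block at positions [2 i] and [2 i + 1], also for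
    negative [i], because the division rounds down. *)
Definition substitution (x : bi_seq) : bi_seq :=
  fun i => ((i %% 2)%Z != 0) (+) x (i %/ 2)%Z.

Lemma substitution_continuous : continuous substitution.
Proof.
apply: local_continuous => j; exists (j %/ 2)%Z => x y.
by rewrite /substitution => ->.
Qed.

Lemma substitution_even (x : bi_seq) (i : int) : substitution x (2 * i) = x i.
Proof.
rewrite /substitution; have -> : (2 * i %/ 2)%Z = i by lia.
by have -> : (2 * i %% 2)%Z = 0 by lia.
Qed.

Lemma substitution_odd (x : bi_seq) (i : int) :
  substitution x (2 * i + 1) = ~~ x i.
Proof.
rewrite /substitution; have -> : ((2 * i + 1) %/ 2)%Z = i by lia.
by have -> : ((2 * i + 1) %% 2)%Z = 1 by lia.
Qed.

Lemma substitution_bit (x : bi_seq) (m : nat) (r : bool) :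
  substitution x (2 * m + r)%N%:Z = r (+) x m%:Z.
Proof.
case: r; rewrite ?addn1 ?addn0.
  have -> : (2 * m).+1%:Z = 2 * m%:Z + 1 by lia.
  by rewrite substitution_odd.
by rewrite PoszM substitution_even.
Qed.

(** Position [2 m + r + 1] is the second place of block [m] if [r] is 0 and the first place of block
    [m + 1] if [r] is 1. *)
Lemma shift_substitution_bit (x : bi_seq) (m : nat) (r : bool) :
  shift 1 (substitution x) (2 * m + r)%N%:Z = ~~ r (+) x (m + r)%N%:Z.
Proof.
rewrite /shift; case: r; rewrite ?addn1 ?addn0.
  have -> : (2 * m).+1%:Z + 1 = 2 * m.+1%:Z by lia.
  by rewrite substitution_even.
by rewrite PoszM substitution_odd.
Qed.

Lemma shift_substitution (i : int) (x : bi_seq) :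
  substitution (shift i x) = shift (2 * i) (substitution x).
Proof.
apply/funext => j; rewrite /substitution /shift.
have -> : ((j + 2 * i) %/ 2)%Z = (j %/ 2)%Z + i by lia.
by have -> : ((j + 2 * i) %% 2)%Z = (j %% 2)%Z by lia.
Qed.

Lemma shiftD (i j : int) (x : bi_seq) : shift i (shift j x) = shift (i + j) x.
Proof. by apply/funext => k; rewrite /shift addrA. Qed.

(* Letters 5 and 6 of [w] are both +1, so for odd [k] the factor of [w] around
   6 * 2^k is the factor of [substitution w] around 0. *)
Lemma shift_w_substitution (k : nat) (j : int) : odd k -> (`|j| < 2 ^ k)%N ->
  shift (6 * 2 ^ k)%N%:Z w j = substitution w j.
Proof.
rewrite /shift /substitution => k_odd.
case: j => [n|n] nk.
  have -> : n%:Z + (6 * 2 ^ k)%N%:Z = (6 * 2 ^ k + n)%N%:Z by lia.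
  have -> : (n%:Z %/ 2)%Z = n./2%:Z by lia.
  rewrite [LHS]thue_morse_block //=; have [->|n0] := posnP n; first by [].
  rewrite [in LHS]thue_morse_half //.
  by congr (_ (+) _); have -> : ((n%:Z %% 2)%Z != 0) = odd n by lia.
(* Negative positions fall into the block of letter 5, read backwards; for odd [k] mirroring negates
   each letter, matching the left half of [substitution w]. *)
have -> : Negz n + (6 * 2 ^ k)%N%:Z = (5 * 2 ^ k + ((2 ^ k).-1 - n))%N%:Z.
  have := expn_gt0 2 k; move: nk; lia.
have nk' : (n < 2 ^ k)%N by move: nk; lia.
have -> : (Negz n %/ 2)%Z = Negz n./2 by lia.
rewrite [LHS]thue_morse_block ?thue_morse_mirror //; last by move: nk'; lia.
rewrite k_odd /=; have [->|n0] := posnP n; first by [].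
rewrite thue_morse_half // -addNb.
by congr (_ (+) _); have -> : ((Negz n %% 2)%Z != 0) = ~~ odd n by lia.
Qed.

(** Around the origin [w] reads +1, +1 but [substitution w] reads -1, +1, so the two differ. The
    latter is the limit of translates of [w] that agree with it on growing windows. *)
Lemma hull_substitution_w : hull (substitution w).
Proof.
apply: (@closed_cvg _ _ \oo _ (fun a => shift (6 * 2 ^ a.*2.+1)%N%:Z w) hull).
- exact: closed_closure.
- by apply: nearW => a; apply: subset_closure; exists (6 * 2 ^ a.*2.+1)%N%:Z.
apply: cvg_bi_seq => j.
suff : \forall a \near \oo,
  shift (6 * 2 ^ a.*2.+1)%N%:Z w j = substitution w j by [].
near=> a.
apply: shift_w_substitution; first by rewrite /= odd_double.
have : (`|j| <= a)%N by near: a; exact: nbhs_infty_ge.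
by have := ltn_expl a.*2.+1 (isT : 1 < 2)%N; lia.
Unshelve. all: by end_near. Qed.

(** The preimage of [closure A] is closed and contains [A]. *)
Lemma closure_stable (f : bi_seq -> bi_seq) (A : set bi_seq) : continuous f ->
  (forall x, A x -> closure A (f x)) ->
  forall x, closure A x -> closure A (f x).
Proof.
move=> fc fA x; rewrite {1}closureE => /(_ (f @^-1` closure A)).
apply; split => //.
by apply: preimage_closed => //; exact: closed_closure.
Qed.

Lemma hull_shift (i : int) (x : bi_seq) : hull x -> hull (shift i x).
Proof.
apply: closure_stable => [|_ [j _ <-]]; first exact: shift_continuous.
by rewrite shiftD; apply: subset_closure; exists (i + j).
Qed.

Lemma hull_substitution (x : bi_seq) : hull x -> hull (substitution x).
Proof.
apply: closure_stable => [|_ [j _ <-]]; first exact: substitution_continuous.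
by rewrite shift_substitution; apply: hull_shift; exact: hull_substitution_w.
Qed.

(** * Borel measurability of the letters, the hull and the maps *)

(** The integrand of a correlation is [sign] of this bit, as [sign] turns xor into product. *)
Definition letter_xor (d : nat) (m : 'I_d -> int) (x : bi_seq) : bool :=
  x 0 (+) \big[addb/false]_(i < d) x (m i).

Lemma measurable_addb (d : measure_display) (T : measurableType d)
    (f g : T -> bool) : measurable [set x | f x] -> measurable [set x | g x] ->
  measurable [set x | f x (+) g x].
Proof.
move=> mf mg; have -> : [set x | f x (+) g x] =
    ([set x | f x] `\` [set x | g x]) `|` ([set x | g x] `\` [set x | f x]).
  by apply/seteqP; split => x /=; case: (f x); case: (g x) => //=; intuition.
by apply: measurableU; exact: measurableD.
Qed.

Lemma measurable_letter (i : int) :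
  measurable ([set x | (x : bi_seq) i] : set borel_bi_seq).
Proof.
apply: sub_sigma_algebra; rewrite /= openE => x /= xi.
by apply: filterS (near_proj x i) => y /= ->.
Qed.

Lemma measurable_letter_xor (d : nat) (m : 'I_d -> int) :
  measurable ([set x | letter_xor m x] : set borel_bi_seq).
Proof.
apply: (@measurable_addb _ borel_bi_seq); first exact: measurable_letter.
elim: (index_enum _) => [|i s IH].
  under eq_set do rewrite big_nil.
  by rewrite (_ : [set _ | false] = set0) //; apply/seteqP; split.
under eq_set do rewrite big_cons.
by apply: (@measurable_addb _ borel_bi_seq) => //; exact: measurable_letter.
Qed.

Lemma measurable_hull : measurable (hull : set borel_bi_seq).
Proof.
rewrite -[hull]setCK; apply: measurableC; apply: sub_sigma_algebra.
by rewrite /= openC; exact: closed_closure.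
Qed.

Definition borel_substitution : borel_bi_seq -> borel_bi_seq := substitution.

Definition borel_shift_substitution : borel_bi_seq -> borel_bi_seq :=
  shift 1 \o substitution.

Lemma borel_substitution_meas : measurable_fun setT borel_substitution.
Proof. by apply: continuous_borel; exact: substitution_continuous. Qed.

Lemma borel_shift_substitution_meas :
  measurable_fun setT borel_shift_substitution.
Proof.
apply: continuous_borel => x; apply: continuous_comp.
  exact: substitution_continuous.
exact: shift_continuous.
Qed.

HB.instance Definition _ :=
  isMeasurableFun.Build _ _ _ _ _ borel_substitution_meas.
HB.instance Definition _ :=
  isMeasurableFun.Build _ _ _ _ _ borel_shift_substitution_meas.

(** * The renormalized measure and its invariance *)

Section Renormalization.
Variables (R : realType) (mu : probability borel_bi_seq R).
Local Open Scope ereal_scope.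

Let half_ge0 : (0 <= 2^-1 :> R)%R. Proof. by rewrite invr_ge0. Qed.

(** Averages the image of [mu] over the two places of the origin within a block of theta. *)
Definition renormalization : set borel_bi_seq -> \bar R :=
  mscale (NngNum half_ge0) (measure_add
    (distribution mu borel_substitution)
    (distribution mu borel_shift_substitution)).

HB.instance Definition _ := Measure.on renormalization.

Lemma renormalizationE (A : set borel_bi_seq) : renormalization A =
  2^-1%:E * (mu (borel_substitution @^-1` A) +
           mu (borel_shift_substitution @^-1` A)).
Proof. by congr (_ * _); exact: measure_addE. Qed.

Lemma renormalization_setT : renormalization setT = 1.
Proof.
rewrite renormalizationE !preimage_setT probability_setT.
by rewrite -EFinD -EFinM; congr EFin; lra.
Qed.

HB.instance Definition _ := Measure_isProbability.Build _ _ _ renormalization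
  renormalization_setT.

(** The shift exchanges the two summands: it turns theta into S theta, and S theta into theta S,
    where the inner S is absorbed by the invariance of [mu]. *)
Lemma renormalization_invariant : invariant_probability mu ->
  invariant_probability renormalization.
Proof.
move=> [mu_hull mu_shift]; split=> [|A mA].
  have preim1 (f : {mfun borel_bi_seq >-> borel_bi_seq}) :
      (forall x, hull x -> hull (f x)) -> mu (f @^-1` hull) = 1.
    move=> fhull; apply/eqP; rewrite eq_le -{2}mu_hull.
    have mf : measurable (f @^-1` hull).
      by rewrite -[X in measurable X]setTI; apply: measurable_funPT;
        [|exact: measurable_hull].
    rewrite probability_le1 //=; apply: le_measure; rewrite ?inE //.
    exact: measurable_hull.
  rewrite [LHS]renormalizationE !preim1.
  - by rewrite -EFinD -EFinM; congr EFin; lra.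
  - by move=> x hx; exact/hull_shift/hull_substitution.
  - exact: hull_substitution.
rewrite [LHS]renormalizationE [RHS]renormalizationE addeC; congr (_ * (_ + _)).
rewrite -(mu_shift (borel_substitution @^-1` A)); last first.
  by rewrite -[X in measurable X]setTI; apply: measurable_funPT.
congr (mu _); apply/funext => x; congr (A _).
rewrite /borel_shift_substitution /= shiftD /borel_substitution.
by rewrite shift_substitution.
Qed.

End Renormalization.

(** * Correlations as measures of sets, and their recursion *)

Lemma sign_addb (R : realType) (a b : bool) :
  sign R (a (+) b) = sign R a * sign R b.
Proof. by rewrite /sign signr_addb. Qed.

Lemma probability_setI_full (R : realType) (d : measure_display)
    (T : measurableType d) (P : probability T R) (A D : set T) :
  measurable A -> measurable D ->
  P D = 1%E -> P (A `&` D) = P A.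
Proof.
move=> mA mD PD; rewrite [RHS](measureDI P mA mD).
rewrite [X in _ = (X + _)%E](_ : _ = 0%E) ?add0e //.
apply: (@subset_measure0 _ _ _ _ _ (~` D)).
- exact: measurableD.
- exact: measurableC.
- by move=> x [].
- by rewrite [LHS]probability_setC // PD subee.
Qed.

Section Correlation.
Variables (R : realType) (mu : probability borel_bi_seq R).
Hypothesis mu_hull : mu hull = 1%E.

(** The integrand is 1 minus twice an indicator and the hull has full measure. Correlations thus
    depend on the measure of one set, and no change of variables in integrals is required. *)
Lemma correlationE (n : nat) (m : 'I_n.-1 -> int) :
  correlation mu m = 1 - 2 * fine (mu [set x | letter_xor m x]).
Proof.
have mB : measurable ([set x | letter_xor m x] : set borel_bi_seq).
  exact: measurable_letter_xor.
have mH := measurable_hull.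
have -> : correlation mu m = \int[mu]_(x in hull)
    (1 - 2 * \1_([set x | letter_xor m x]) (x : borel_bi_seq)).
  rewrite /correlation; apply: eq_Rintegral => x _.
  rewrite -(big_morph (sign R) (@sign_addb R) (erefl : sign R false = 1)).
  rewrite -sign_addb -/(letter_xor m x) indicE /sign.
  case: (boolP (letter_xor m x)) => xB.
    by rewrite mem_set //= expr1; lra.
  by rewrite memNset; [rewrite /= expr0; lra|exact/negP].
have mu_int (f : borel_bi_seq -> R) : mu.-integrable setT (EFin \o f) ->
  mu.-integrable hull (EFin \o f) by apply: integrableS.
have intI : mu.-integrable hull
    (EFin \o (\1_([set x | letter_xor m x]) : borel_bi_seq -> R)).
  by apply: mu_int; exact: integrable_indic.
rewrite RintegralB //; last 2 first.
  exact: finite_measure_integrable_cst.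
  rewrite (_ : EFin \o _ = (fun x : borel_bi_seq => 2%:E *
    (\1_([set x | letter_xor m x]) x)%:E)%E); last by apply/funext.
  exact: integrableZl.
rewrite RintegralZl // Rintegral_cst // [X in 1 * fine X - _]mu_hull mulr1.
congr (_ - _ * _); rewrite /Rintegral integral_indic //; congr fine.
exact: probability_setI_full.
Qed.

End Correlation.

Section MeanSign.
Variables (R : realType) (mu : probability borel_bi_seq R).

(* The integral of [sign R \o b]. *)
Definition mean_sign (b : bi_seq -> bool) : R :=
  1 - 2 * fine (mu [set x | b x]).

Lemma mean_sign_addb (c : bool) (b : bi_seq -> bool) :
  measurable ([set x | b x] : set borel_bi_seq) ->
  mean_sign (fun x => c (+) b x) = (-1) ^+ c * mean_sign b.
Proof.
move=> mb; case: c => /=; last by rewrite expr0 mul1r.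
rewrite /mean_sign (_ : [set x | ~~ b x] = ~` [set x | b x]); last first.
  by apply/seteqP; split => x /= /negP.
rewrite probability_setC // fineB ?fin_num_measure //= expr1; ring.
Qed.

(** By uniqueness [mu] equals its renormalization; the weights 1/2 add up to 1, so the constant term
    of [mean_sign] is preserved. *)
Lemma mean_sign_renormalization (b : bi_seq -> bool) :
  unique_invariant_probability mu ->
  measurable ([set x | b x] : set borel_bi_seq) ->
  mean_sign b = 2^-1 * (mean_sign (b \o substitution) +
                        mean_sign (b \o (shift 1 \o substitution))).
Proof.
move=> [mu_inv mu_uniq] mb.
rewrite {1}/mean_sign -(mu_uniq _ (renormalization_invariant mu_inv)) //.
rewrite [X in fine X]renormalizationE.
have mpre (f : {mfun borel_bi_seq >-> borel_bi_seq}) :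
    mu (f @^-1` [set x | b x]) \is a fin_num.
  apply: fin_num_measure; rewrite -[X in measurable X]setTI.
  exact: measurable_funPT.
rewrite fineM ?fin_numD ?mpre // fineD ?mpre //= /mean_sign.
rewrite -/(borel_substitution @^-1` [set x | b x]).
rewrite -/(borel_shift_substitution @^-1` [set x | b x]).
lra.
Qed.

Lemma big_addb_bits (d : nat) (r b : 'I_d -> bool) :
  \big[addb/false]_(i < d) (r i (+) b i) =
  odd (\sum_(i < d) r i) (+) \big[addb/false]_(i < d) b i.
Proof.
rewrite big_split; congr (_ (+) _).
rewrite (big_morph odd oddD (erefl : odd 0 = false)).
by apply: eq_bigr => i _; rewrite oddb.
Qed.

Lemma correlation_recursion (n : nat) : (0 < n)%N ->
  unique_invariant_probability mu ->
  recursion_solutions (fun m : 'I_n.-1 -> nat =>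
    correlation mu (n := n) (fun i => (m i)%:Z)).
Proof.
move=> n_gt0 mu_uniq m r; have mu_hull := mu_uniq.1.1.
rewrite !correlationE // -!/(mean_sign _).
rewrite mean_sign_renormalization //; last exact: measurable_letter_xor.
set s := (\sum_(i < n.-1) r i)%N.
have -> : letter_xor (fun i => (2 * m i + r i)%N%:Z) \o substitution =
    fun x => odd s (+) letter_xor (fun i => (m i)%:Z) x.
  apply/funext => x /=; rewrite /letter_xor.
  under eq_bigr do rewrite substitution_bit.
  rewrite big_addb_bits -[in LHS](mulr0 2) substitution_even.
  by rewrite addbCA.
(* Here the letters with [r i] = 0 are negated, and so is [x 0]: [n - r] sign changes in all,
   against [r] for theta alone. *)
have -> : letter_xor (fun i => (2 * m i + r i)%N%:Z) \o
      (shift 1 \o substitution) =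
    fun x => (odd n (+) odd s) (+) letter_xor (fun i => (m i + r i)%N%:Z) x.
  apply/funext => x /=; rewrite /letter_xor.
  under eq_bigr do rewrite shift_substitution_bit.
  rewrite big_addb_bits.
  have -> : shift 1 (substitution x) 0 = ~~ x 0.
    rewrite /shift add0r -[in LHS](addr0 1) addrC -[in LHS](mulr0 2).
    by rewrite substitution_odd.
  have -> : odd (\sum_(i < n.-1) ~~ r i)%N = odd n.-1 (+) odd s.
    have /(congr1 odd) : n.-1 = (\sum_(i < n.-1) ~~ r i + s)%N.
      rewrite /s -big_split /= -[LHS](card_ord n.-1) -sum1_card.
      by apply: eq_bigr => i _; case: (r i).
    by rewrite oddD => ->; rewrite addbK.
  have -> : odd n = ~~ odd n.-1 by rewrite -[in LHS](prednK n_gt0).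
  by case: (odd n.-1); case: (odd s); case: (x 0);
    case: (\big[addb/false]_(i < _) _).
rewrite !mean_sign_addb; try exact: measurable_letter_xor.
rewrite signr_addb !signr_odd; ring.
Qed.

End MeanSign.

Theorem corollary4p5 (R : realType) (n : nat) (n_gt0 : (0 < n)%N) :
  [/\ (~~ odd n -> has_dimension (@recursion_solutions R n) 1),
      (odd n -> has_dimension (@recursion_solutions R n) 0)
    & forall mu : probability borel_bi_seq R,
        unique_invariant_probability mu ->
        let eta := fun m : 'I_n.-1 -> nat =>
          correlation mu (n := n) (fun i => (m i)%:Z) in
        recursion_solutions eta /\
        forall f : ('I_n.-1 -> nat) -> R, recursion_solutions f ->
          f (fun=> 0%N) = eta (fun=> 0%N) -> f = eta].
Proof.
split.
- exact: recursion_solutions_even_dim.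
- exact: recursion_solutions_odd_dim.
- move=> mu mu_uniq eta; have etaS := correlation_recursion n_gt0 mu_uniq.
  by split=> // f fS; exact: recursion_solutions_inj.
Qed.
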